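(* Let $(X,T)$ be a topological dynamical system and $\mu\in M(X,T)$. If there exists a subsequence $A$ of $\mathbb{N}$ with $\bar{D}(A)>0$ such that $(X,T)$ is $\mu$-$A$-mean-equicontinuous, then $(X,\mathcal{B},\mu,T)$ is rigid.
   Context: A topological dynamical system $(X,T)$ is a non-empty compact metric space $X$ with metric $d$ together with a homeomorphism $T:X\to X$. $\mathcal{B}$ is the Borel $\sigma$-algebra of $X$ and $M(X,T)$ is the set of $T$-invariant regular Borel probability measures on $X$. $\mathbb{N}=\{0,1,2,\dots\}$. A subsequence $A=\{a_i:i\in\mathbb{N}\}$ of $\mathbb{N}$ is an infinite set of natural numbers listed in strictly increasing order $a_0<a_1<\cdots$. Its upper density is $\bar{D}(A)=\limsup_{n\to\infty}\frac{|A\cap[0,n-1]|}{n}$. $(X,\mathcal{B},\mu,T)$ is rigid if there is a subsequence $\{t_k\}$ of $\mathbb{N}$ such that $f\circ T^{t_k}\to f$ in $L^2(\mu)$ for all $f\in L^2(\mu)$. For $x,y\in X$ and $n\geq1$ let $\bar{d}_n^A(x,y)=\frac1n\sum_{i=0}^{n-1}d(T^{a_i}x,T^{a_i}y)$. A subset $K\subset X$ is $A$-mean-equicontinuous if for every $\epsilon>0$ there is $\delta>0$ such that for all $x,y\in K$ with $d(x,y)<\delta$ one has $\limsup_{n\to\infty}\bar{d}_n^A(x,y)<\epsilon$. $(X,T)$ is $\mu$-$A$-mean-equicontinuous if for every $\tau>0$ there is a compact $A$-mean-equicontinuous set $K\subset X$ with $\mu(K)>1-\tau$. *)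

(* Defs.v *)
From HB Require Import structures.
From mathcomp Require Import all_boot all_order all_algebra.
From mathcomp Require Import all_classical all_reals all_analysis.

Set Implicit Arguments.
Unset Strict Implicit.
Unset Printing Implicit Defensive.
Import Order.TTheory GRing.Theory Num.Theory.
Import numFieldNormedType.Exports.

Local Open Scope classical_set_scope.
Local Open Scope ring_scope.

(* Measurable types are pointed in the library, so the Borel sigma-algebra is
   available on a metric space only once it is pointed; being pointed is exactly
   how nonemptiness of the space is expressed. *)
#[short(type="pmetricType")]
HB.structure Definition PointedMetric (K : numDomainType) :=
  { M of Metric K M & Pointed M }.

Notation borel X := (g_sigma_algebraType (@open X)).

Definition homeomorphism (X Y : topologicalType) (f : X -> Y) : Prop :=
  exists g : Y -> X,
    [/\ cancel f g, cancel g f, continuous f & continuous g].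

Definition regular (R : realType) (X : pmetricType R)
    (mu : probability (borel X) R) : Prop :=
  forall B : set (borel X), measurable B ->
    mu B = ereal_inf [set mu U | U in [set U : set X | open U /\ B `<=` U]] /\
    mu B = ereal_sup [set mu K | K in [set K : set X | compact K /\ K `<=` B]].

Definition invariant_measure (R : realType) (d : measure_display)
    (X : measurableType d) (mu : probability X R) (T : X -> X) : Prop :=
  forall B : set X, measurable B -> mu (T @^-1` B) = mu B.

(* A subsequence of the natural numbers is given by its increasing enumeration
   [a : nat -> nat] with [increasing_seq a]; the underlying set is [range a]. *)
Definition upper_density (R : realType) (A : set nat) : \bar R :=
  limn_esup (fun n : nat => (#|[pred i : 'I_n | `[< A i >]]|%:R / n%:R : R)%:E).

Definition mean_dist (R : realType) (X : metricType R) (T : X -> X)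
    (a : nat -> nat) (n : nat) (x y : X) : R :=
  n%:R^-1 * \sum_(i < n) mdist (iter (a i) T x) (iter (a i) T y).

Definition mean_equicontinuous_set (R : realType) (X : metricType R)
    (T : X -> X) (a : nat -> nat) (K : set X) : Prop :=
  forall eps : R, 0 < eps -> exists2 delta : R, 0 < delta &
    forall x y : X, K x -> K y -> mdist x y < delta ->
      (limn_esup (fun n => (mean_dist T a n x y)%:E) < eps%:E)%E.

Definition measure_mean_equicontinuous (R : realType) (X : pmetricType R)
    (mu : probability (borel X) R) (T : X -> X) (a : nat -> nat) : Prop :=
  forall tau : R, 0 < tau -> exists K : set X,
    [/\ compact K, mean_equicontinuous_set T a K & ((1 - tau)%:E < mu K)%E].

Definition rigid (R : realType) (d : measure_display) (X : measurableType d)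
    (mu : probability X R) (T : X -> X) : Prop :=
  exists t : nat -> nat, increasing_seq t /\
    forall f : X -> R, f \in Lfun mu 2%:E ->
      'N[mu]_2%:E[(fun x => (f (iter (t k) T x) - f x)%:E)]%E @[k --> \oo]
        --> 0%E.

(* Main.v *)
Require Import Defs.
From HB Require Import structures.
From mathcomp Require Import all_boot all_order all_algebra.
From mathcomp Require Import all_classical all_reals all_analysis.
From mathcomp Require Import measurable_realfun ring lra zify.

Set Implicit Arguments.
Unset Strict Implicit.
Unset Printing Implicit Defensive.
Import Order.TTheory GRing.Theory Num.Theory.
Import numFieldNormedType.Exports.
Import HBSimple.

Local Open Scope classical_set_scope.
Local Open Scope ring_scope.

(** Rigidity amounts to finding return times: numbers n as large as desired for
    which T^n moves all but a small set of points by a small distance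
    (recurrence_in_measure).

    These times come from differences of terms of the sequence a. Let K be a
    compact mean equicontinuous set of measure close to 1 and cover it by small
    balls centred at finitely many points y of K. Each x in K is then shadowed by
    some centre y: the average of d(T^(a i) x, T^(a i) y) over i < n is small for n
    large. After discarding a small set, the rank from which this holds does not
    depend on x, so that the averages can be integrated; hence for infinitely many i
    the point T^(a i) x is close to T^(a i) y for most x
    (frequently_small_of_small_averages). By compactness of a finite power of X, two
    of these indices, i < j and far apart, have T^(a i) y and T^(a j) y close for all
    centres at once (simultaneous_return). Then T^(a i) x and T^(a j) x are close for
    most x and, mu being invariant, so are x and T^(a j - a i) x.

    Let the maps S k be iterates of T that converge to the identity in measure.
    Regularity of mu squeezes a Borel set between a compact set and an open set of
    almost the same measure, so most points of a Borel set stay in it under S k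
    (set_recurrence). This gives convergence of f o S k to f for simple f, then in
    L1 by density, because composition with S k is an isometry (L1_recurrence). The
    case of L2 follows from that of L1 applied to the signed square f |f|, thanks to
    |a - b|^2 <= 2 |a|a| - b|b|| (sqr_dist_le_signed_sqr). *)

(** * Metric preliminaries and Borel measurability *)

(** The net is taken inside K because mean equicontinuity says nothing about
    points outside K. *)
Lemma compact_finite_net (R : realType) (X : pmetricType R) (K : set X)
    (delta : R) : compact K -> 0 < delta ->
  exists2 s : seq X, (forall y, y \in s -> K y) &
    forall x, K x -> exists2 y, y \in s & mdist x y < delta.
Proof.
move=> cK d0; move: cK; rewrite compact_cover => cK.
have [||D DK KD] := cK X K (fun y => (ball y delta)^°).
- by move=> y _; exact: open_interior.
- move=> x Kx; exists x => //; apply: nbhsx_ballx => //.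
exists (finmap.enum_fset D) => [y /DK|x /KD [y /= yD]]; first by rewrite inE.
move/interior_subset; rewrite ballEmdist/= => xy; exists y => //.
by rewrite metric_sym.
Qed.

Lemma mdist_continuous (R : realType) (X : metricType R) (f g : X -> X) :
  continuous f -> continuous g -> continuous (fun x => mdist (f x) (g x)).
Proof.
move=> cf cg x; apply/cvgrPdist_lt => e e0.
have e20 : 0 < e / 2 by rewrite divr_gt0.
near=> y.
have fy : mdist (f x) (f y) < e / 2.
  by near: y; apply: metricType_numDomainType.cvgr_dist_lt => //; exact: cf.
have gy : mdist (g x) (g y) < e / 2.
  by near: y; apply: metricType_numDomainType.cvgr_dist_lt => //; exact: cg.
have := metric_triangle (f x) (f y) (g x).
have := metric_triangle (f y) (g y) (g x).
have := metric_triangle (f y) (f x) (g y).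
have := metric_triangle (f x) (g x) (g y).
rewrite (metric_sym (f y) (f x)) (metric_sym (g y) (g x)) => *.
rewrite ltr_norml; apply/andP; split; lra.
Unshelve. all: by end_near. Qed.

Lemma continuous_iter (X : topologicalType) (T : X -> X) n :
  continuous T -> continuous (iter n T).
Proof.
move=> cT; elim: n => [|n ih] x; first exact: cvg_id.
exact: (continuous_comp (ih x) (cT _)).
Qed.

Lemma open_borel (R : realType) (X : pmetricType R) (U : set X) :
  open U -> measurable (U : set (borel X)).
Proof. by move=> oU; exact: sub_sigma_algebra. Qed.

Lemma compact_borel (R : realType) (X : pmetricType R) (K : set X) :
  compact K -> measurable (K : set (borel X)).
Proof.
move=> cK; rewrite -[K]setCK; apply: measurableC; apply: open_borel.
by rewrite openC; apply: compact_closed => //; exact: metric_hausdorff.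
Qed.

Lemma continuous_borel (R : realType) (X : pmetricType R) (f : X -> X) :
  continuous f -> measurable_fun setT (f : borel X -> borel X).
Proof.
move=> cf; apply: (@measurability _ _ (borel X) (borel X) setT f (@open X)) => [//|].
move=> _ [U oU <-].
by rewrite setTI; apply: open_borel; exact: open_comp.
Qed.

Lemma continuous_borel_real (R : realType) (X : pmetricType R) (f : X -> R) :
  continuous f -> measurable_fun setT (f : borel X -> R).
Proof.
move=> cf; apply: (measurability _ (RGenOInfty.measurableE R)).
move=> _ [_ [a ->] <-].
by rewrite setTI; apply: open_borel; apply: open_comp.
Qed.

Lemma measurable_superlevel d (S : measurableType d) (R : realType)
    (f : S -> R) (r : R) :
  measurable_fun setT f -> measurable [set x | r <= f x].
Proof.
move=> mf; rewrite -[X in measurable X]setTI.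
have := mf measurableT _ (measurable_itv `[r, +oo[).
congr (measurable (_ `&` _)).
by apply/seteqP; split => x /=; rewrite in_itv/= andbT.
Qed.

Lemma measurable_neq d (S : measurableType d) (R : realType) (f g : S -> R) :
  measurable_fun setT f -> measurable_fun setT g ->
  measurable [set x | f x != g x].
Proof.
move=> mf mg.
rewrite (_ : [set x | _] = (fun x => f x - g x) @^-1` [set~ 0]).
  rewrite -[X in measurable X]setTI.
  by apply: measurable_funB => //; exact: measurableC.
by apply/seteqP; split => x /=; rewrite -subr_eq0 => /eqP.
Qed.

Lemma displacement_borel (R : realType) (X : pmetricType R) (f : X -> X)
    (r : R) :
  continuous f -> measurable ([set x | r <= mdist (f x) x] : set (borel X)).
Proof.
move=> cf; apply: (@measurable_superlevel _ (borel X)).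
apply: continuous_borel_real; apply: mdist_continuous => // x; exact: cvg_id.
Qed.

Lemma mean_dist_borel (R : realType) (X : pmetricType R) (T : X -> X)
    (a : nat -> nat) n (y : X) : continuous T ->
  measurable_fun setT ((fun x => mean_dist T a n x y) : borel X -> R).
Proof.
move=> cT; apply: measurable_funM; first exact: measurable_cst.
apply: measurable_sum => i; apply: continuous_borel_real.
by apply: mdist_continuous; [exact: continuous_iter|move=> ?; exact: cvg_cst].
Qed.

(** * Measurable selection and measure preservation *)

(** Choosing the first admissible element of a finite list is a measurable
    selection: it splits the space into finitely many measurable pieces, on each
    of which the choice is constant. *)
Lemma measurable_fun_first_choice (R : realType) d (S : measurableType d)
    (I : eqType) (i0 : I) (p : S -> pred I) (g : S -> I -> R) (s : seq I) :
  (forall i, measurable [set x | p x i]) ->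
  (forall i, measurable_fun setT (g ^~ i)) ->
  measurable_fun setT (fun x => g x (nth i0 s (find (p x) s))).
Proof.
move=> mp mg; elim: s => [|i s ih] /=; first exact: mg.
rewrite (_ : (fun x => _) =
    (fun x => if p x i then g x i else g x (nth i0 s (find (p x) s)))); last first.
  by apply/funext => x; case: ifP.
apply: measurable_fun_ifT => //; apply: (measurable_fun_bool true).
by rewrite setTI; exact: mp.
Qed.

Lemma measurable_has d (S : measurableType d) (I : eqType) (p : S -> pred I)
    (s : seq I) :
  (forall i, measurable [set x | p x i]) -> measurable [set x | has (p x) s].
Proof.
move=> mp; elim: s => [|i s ih] /=; first by rewrite set_false.
rewrite (_ : [set x | _] = [set x | p x i] `|` [set x | has (p x) s]).
  exact: measurableU.
by apply/seteqP; split => x /=; [move/orP|move=> ?; apply/orP].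
Qed.

(** This turns a bound that holds from some rank depending on the point into a
    bound that holds from a common rank outside a small set. *)
Lemma probability_bigcup_gt d (S : measurableType d) (R : realType)
    (mu : probability S R) (E : nat -> set S) (K : set S) (r : \bar R) :
  (forall n, measurable (E n)) -> {homo E : m n / (m <= n)%N >-> m `<=` n} ->
  measurable K -> K `<=` \bigcup_n E n -> (r < mu K)%E ->
  exists n, (r < mu (E n))%E.
Proof.
move=> mE ndE mK KE rK; apply: contrapT => /forallNP small.
have mUE : measurable (\bigcup_n E n) by exact: bigcupT_measurable.
have cvE : mu \o E @ \oo --> mu (\bigcup_n E n).
  by apply: nondecreasing_cvg_mu => // m n mn; apply/subsetPset; exact: ndE.
suff : (mu (\bigcup_n E n) <= r)%E.
  by apply/negP; rewrite -ltNge (lt_le_trans rK)// le_measure// inE.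
rewrite -(cvg_lim _ cvE)//; apply: lime_le.
  by apply/cvg_ex; eexists; exact: cvE.
by apply: nearW => n; rewrite leNgt; apply/negP; exact: small.
Qed.

Lemma invariant_measure_iter d (S : measurableType d) (R : realType)
    (mu : probability S R) (T : S -> S) n :
  measurable_fun setT T -> invariant_measure mu T ->
  invariant_measure mu (iter n T).
Proof.
move=> mT inv; elim: n => [//|n ih] B mB.
rewrite -[RHS]inv// -[RHS]ih//.
by rewrite -[X in measurable X]setTI; exact: mT.
Qed.

Lemma integral_invariant_measure d (Y : measurableType d) (R : realType)
    (mu : probability Y R) (S : Y -> Y) (f : Y -> \bar R) :
  measurable_fun setT S -> invariant_measure mu S -> measurable_fun setT f ->
  (forall x, 0 <= f x)%E -> (\int[mu]_x f (S x) = \int[mu]_x f x)%E.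
Proof.
move=> mS invS mf f0.
rewrite -[LHS](@ge0_integral_pushforward _ _ _ _ _ _ mS mu setT f)//.
by apply: eq_measure_integral => A mA _; exact: invS.
Qed.

(** * Recurrence in measure along differences of the sequence *)

Lemma limn_esup_lt_near (R : realType) (u : (\bar R)^nat) (l : \bar R) :
  (limn_esup u < l)%E -> \forall n \near \oo, (u n < l)%E.
Proof.
move=> /ereal_inf_lt[_ [V Voo <-] supVl].
apply: filterS Voo => n Vn; apply: le_lt_trans supVl.
by apply: ereal_sup_ubound; exists n.
Qed.

(** Small averages force small terms infinitely often, and smallness of the
    integral of a nonnegative function is smallness in measure by Markov's
    inequality. The pointwise bound on averages is assumed uniform on E, so that
    it can be integrated at a single fixed n. *)
Lemma frequently_small_of_small_averages d (S : measurableType d)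
    (R : realType) (mu : probability S R) (E : set S) (phi : nat -> S -> R)
    (eta : R) (N : nat) :
  measurable E -> (forall i, measurable_fun setT (phi i)) ->
  (forall i x, 0 <= phi i x) -> 0 < eta ->
  (forall n x, (N <= n)%N -> E x -> \sum_(i < n) phi i x <= n%:R * eta) ->
  forall (eps : R) (i0 : nat), 0 < eps -> exists2 i, (i0 <= i)%N &
    (eps%:E * mu (E `&` [set x | (eps <= phi i x)%R]) <= (2 * eta)%:E)%E.
Proof.
move=> mE mphi phi0 eta0 avg eps i0 eps0; apply: contrapT => small.
pose I i := (\int[mu]_(x in E) (phi i x)%:E)%E.
have large i : (i0 <= i)%N -> ((2 * eta)%:E <= I i)%E.
  move=> ii0; have [//|lt] := leP (2 * eta)%:E (I i).
  exfalso; apply: small; exists i => //; apply: le_trans (ltW lt).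
  have := @le_integral_comp_abse _ _ _ mu E mE (EFin \o phi i) eps id.
  have -> : [set x | (eps%:E <= `|(EFin \o phi i) x|)%E] =
      [set x | eps <= phi i x].
    by apply/seteqP; split => x /=; rewrite lee_fin ger0_norm.
  move=> h; apply: le_trans (h _ _ _ _ _) _ => //.
  - apply/measurable_EFinP; exact: measurable_funTS.
  - by under eq_integral do rewrite /= ger0_norm//.
(* If all terms past i0 exceed 2 eta, then the sum of the first n is at least
   2 (n - i0) eta, which beats n eta as soon as n > 2 i0. *)
pose n := (2 * i0 + N).+1.
have : (\sum_(i < n) I i <= (n%:R * eta)%:E)%E.
  rewrite -ge0_integral_sum//; first last.
  - by move=> i x _; rewrite lee_fin.
  - by move=> i; apply/measurable_EFinP; exact: measurable_funTS.
  apply: (@le_trans _ _ (\int[mu]_(x in E) (n%:R * eta)%:E)%E).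
    apply: ge0_le_integral => //.
    - by move=> x _; apply: sume_ge0 => i _; rewrite lee_fin.
    - apply: emeasurable_sum => i; apply/measurable_EFinP; exact: measurable_funTS.
    - move=> x Ex; rewrite sumEFin lee_fin; apply: avg => //.
      by rewrite /n; lia.
  rewrite integral_cst// -[leRHS]mule1 lee_pmul2l ?lte_fin//.
    exact: probability_le1.
  by rewrite mulr_gt0.
apply/negP; rewrite -ltNge -(big_mkord xpredT I).
rewrite (@big_cat_nat _ _ _ i0)//=; last by rewrite /n; lia.
apply: (@lt_le_trans _ _ (\sum_(i0 <= i < n) (2 * eta)%:E)%E).
  rewrite sumEFin sumr_const_nat lte_fin -[ltRHS]mulr_natl mulrA ltr_pM2r//.
  rewrite -natrM ltr_nat /n; lia.
rewrite -[leLHS]add0e; apply: leeD.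
  by apply: sume_ge0 => i _; apply: integral_ge0 => x _; rewrite lee_fin.
rewrite [leLHS]big_nat_cond [leRHS]big_nat_cond. apply: lee_sum => i.
by rewrite andbT => /andP[? _]; exact: large.
Qed.

Lemma pigeonhole_far (C : finType) (col : nat -> C) (P : set nat) (N : nat) :
  (forall i0, exists2 i, (i0 <= i)%N & P i) ->
  exists i j, [/\ P i, P j, (i + N < j)%N & col i = col j].
Proof.
move=> Pinf; have [g gP] : {g : nat -> nat & forall i, (i <= g i)%N /\ P (g i)}.
  apply: (@choice _ _ (fun i j => (i <= j)%N /\ P j)) => i.
  by have [j] := Pinf i; exists j.
(* e enumerates points of P with gaps larger than N, so that any coincidence
   among the colours of the e k is at the required distance. *)
pose e := fix e k := if k is k'.+1 then g (e k' + N).+1 else g 0%N.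
have Pe k : P (e k) by case: k => [|k] /=; exact: (gP _).2.
have eS k : (e k + N < e k.+1)%N by exact: (gP _).1.
have elt k l : (k < l)%N -> (e k + N < e l)%N.
  elim: l => // l ih; rewrite ltnS leq_eqVlt => /predU1P[->//|/ih].
  by have := eS l; lia.
pose c := fun k : 'I_#|C|.+1 => col (e k).
have /injectivePn[k [l kl ckl]] : ~~ injectiveb c.
  by apply/negP => /injectiveP /leq_card; rewrite card_ord ltnn.
have [lt|lt|/val_inj/eqP] := ltngtP k l; last by rewrite (negPf kl).
- by exists (e k), (e l); split=> //; exact: elt.
- by exists (e l), (e k); split=> //; exact: elt.
Qed.

(** The maps f i, evaluated at the finitely many points of s, give a sequence in
    a power of the compact space X, so two of its terms are close. Compactness is
    used through the pigeonhole principle: i is coloured by recording which balls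
    of a finite eps/2-net contain each of the points f i y. *)
Lemma simultaneous_return (R : realType) (X : pmetricType R) (f : nat -> X -> X)
    (s : seq X) (P : set nat) (eps : R) (N : nat) :
  compact [set: X] -> 0 < eps ->
  (forall i0, exists2 i, (i0 <= i)%N & P i) ->
  exists i j, [/\ P i, P j, (i + N < j)%N &
    forall y, y \in s -> mdist (f i y) (f j y) < eps].
Proof.
move=> cX eps0 Pinf; have e20 : 0 < eps / 2 by rewrite divr_gt0.
have [r _ rP] := compact_finite_net cX e20.
pose col i := [ffun k : 'I_(size s) => [ffun l : 'I_(size r) =>
  mdist (f i (tnth (in_tuple s) k)) (tnth (in_tuple r) l) < eps / 2]].
have [i [j [Pi Pj ij cij]]] := pigeonhole_far col N Pinf.
exists i, j; split=> // y /(tnthP (in_tuple s))[k ->].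
have [_ /(tnthP (in_tuple r))[l ->] il] := rP (f i (tnth (in_tuple s) k)) I.
have jl : mdist (f j (tnth (in_tuple s) k)) (tnth (in_tuple r) l) < eps / 2.
  by move/ffunP/(_ k): cij; rewrite !ffunE => /ffunP/(_ l); rewrite !ffunE il.
rewrite [eps]splitr (le_lt_trans (metric_triangle _ (tnth (in_tuple r) l) _))//.
by rewrite ltrD// metric_sym.
Qed.

Lemma increasing_seq_gap (a : nat -> nat) i k :
  increasing_seq a -> (a i + k <= a (i + k))%N.
Proof.
move=> /increasing_seqP ia; elim: k => [|k ih]; first by rewrite !addn0.
by rewrite !addnS (leq_ltn_trans ih)//; exact: ia.
Qed.

(** The return times are differences a j - a i. Each x in a large set is
    shadowed on average along a by one of finitely many points y of a net; Markov's
    inequality gives infinitely many i for which T^(a i) x is close to T^(a i) y for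
    most x. Two such indices i < j for which T^(a i) y and T^(a j) y are close for
    all y in the net make T^(a i) x and T^(a j) x close for most x, and invariance
    of mu pulls this back to x and T^(a j - a i) x. *)
Lemma recurrence_in_measure (R : realType) (X : pmetricType R) (T : X -> X)
    (mu : probability (borel X) R) (a : nat -> nat) :
  compact [set: X] -> continuous T -> invariant_measure mu T ->
  increasing_seq a -> measure_mean_equicontinuous mu T a ->
  forall (eps : R) (N : nat), 0 < eps -> exists2 n, (N <= n)%N &
    (mu [set x | (eps <= mdist (iter n T x) x)%R] <= eps%:E)%E.
Proof.
move=> cX cT inv inca meq eps N eps0.
(* The budget 5 e is e for the complement of the good set E M below and 2 e
   for each of the two exceptional sets F i and F j. *)
pose e := eps / 5; have e0 : 0 < e by rewrite divr_gt0.
have [K [cK Keq muK]] := meq e e0.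
have e20 : 0 < e ^+ 2 by rewrite exprn_gt0.
have [delta delta0 Kdelta] := Keq _ e20.
have [s sK sP] := compact_finite_net cK delta0.
pose p M (x y : X) :=
  `[< forall n, (M <= n)%N -> mean_dist T a n x y < e ^+ 2 >].
have mp M y : measurable ([set x | p M x y] : set (borel X)).
  rewrite (_ : [set x | _] = \bigcap_(n in [set n | (M <= n)%N])
      [set x | mean_dist T a n x y < e ^+ 2]); last first.
    by apply/seteqP; split => x /=; [move/asboolP|move=> ?; apply/asboolP].
  apply: bigcap_measurable; first by exists M => /=.
  move=> n _; rewrite -[X in measurable X]setTI.
  have := mean_dist_borel a n y cT measurableT (measurable_itv `]-oo, (e ^+ 2)[).
  by congr (measurable (_ `&` _)); apply/seteqP; split => x /=; rewrite in_itv.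
pose E M : set (borel X) := [set x | has (p M x) s].
have mE M : measurable (E M) by apply: measurable_has => y; exact: mp.
have [M muE] : exists M, ((1 - e)%:E < mu (E M))%E.
  apply: (@probability_bigcup_gt _ _ _ mu E K) => //.
  - move=> m n mn x /hasP[y ys /asboolP pxy]; apply/hasP; exists y => //.
    by apply/asboolP => k nk; apply: pxy; exact: leq_trans nk.
  - exact: compact_borel.
  - move=> x Kx; have [y ys xy] := sP _ Kx.
    have /limn_esup_lt_near[M _ MP] := Kdelta _ _ Kx (sK _ ys) xy.
    exists M => //; apply/hasP; exists y => //; apply/asboolP => n Mn.
    by rewrite -lte_fin; exact: MP.
(* On E M, the point c x is the first point of the net that shadows x along the
   sequence; elsewhere it is the default point, which no estimate sees. *)
pose c x := nth point s (find (p M x) s).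
pose phi i x := mdist (iter (a i) T x) (iter (a i) T (c x)).
have mphi i : measurable_fun setT (phi i : borel X -> R).
  apply: (@measurable_fun_first_choice _ _ (borel X) X point (p M)
    (fun x y => mdist (iter (a i) T x) (iter (a i) T y))) => // y.
  apply: continuous_borel_real.
  by apply: mdist_continuous; [exact: continuous_iter|move=> ?; exact: cvg_cst].
have avg n x : (M <= n)%N -> E M x -> \sum_(i < n) phi i x <= n%:R * e ^+ 2.
  move=> Mn /(nth_find point) /asboolP /(_ n Mn) /ltW.
  have [->|n0] := posnP n; first by rewrite big_ord0 mul0r.
  by rewrite /mean_dist ler_pdivrMl// ltr0n.
pose F i := E M `&` [set x | (e <= phi i x)%R].
have mF i : measurable (F i).
  by apply: measurableI => //; exact: (measurable_superlevel e (mphi i)).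
(* With eta = e ^ 2 and threshold e, the exceptional sets have measure at most
   2 e ^ 2 / e = 2 e. *)
have [] := @simultaneous_return _ _ (fun i => iter (a i) T) s
    [set i | (mu (F i) <= (2 * e)%:E)%E] e N cX e0.
  move=> i0; have [i ii0 Fi] := frequently_small_of_small_averages mu (mE M) mphi
    (fun i x => mdist_ge0 _ _) e20 avg i0 e0.
  exists i => //=; rewrite -(@lee_pmul2l _ e%:E)// -EFinM.
  by rewrite (le_trans Fi)// lee_fin expr2 mulrCA.
move=> i [j [/= Fi Fj ij sij]].
have aij : (a i + N <= a j)%N.
  apply: leq_trans (increasing_seq_gap i N inca) _.
  by have := inca (i + N)%N j; rewrite leEnat => ->; exact: ltnW.
exists (a j - a i)%N; first lia.
have mdisp n r :
    measurable ([set x | r <= mdist (iter n T x) x] : set (borel X)).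
  by apply: displacement_borel; exact: continuous_iter.
have epsE : eps = e + 2 * e + 2 * e by rewrite /e; field.
apply: (@le_trans _ _
    (mu [set x | (3 * e <= mdist (iter (a j - a i) T x) x)%R])).
  rewrite le_measure ?inE//= => x /=; apply: le_trans; rewrite epsE; lra.
(* Invariance under the a i-th iterate replaces the displacement of the
   (a j - a i)-th iterate by the distance between the a j-th and a i-th ones. *)
rewrite -(invariant_measure_iter (a i) (continuous_borel cT) inv)//.
apply: (@le_trans _ _ (mu (~` E M `|` F i `|` F j))).
  rewrite le_measure ?inE//.
  - rewrite -[X in measurable X]setTI.
    by apply: continuous_borel => //; exact: continuous_iter.
  - by apply: measurableU => //; apply: measurableU => //; exact: measurableC.
  move=> x /=; rewrite -iterD subnK; last lia.
  move=> far; have [Ex|nEx] := pselect (E M x); last by left; left.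
  have := sij (c x); rewrite mem_nth -?has_find// => /(_ isT) cij.
  have [fi|fi] := leP e (phi i x); first by left; right.
  have [fj|fj] := leP e (phi j x); first by right.
  exfalso; move: far; apply/negP; rewrite -ltNge.
  pose f k := iter (a k) T.
  have := metric_triangle (f j x) (f j (c x)) (f i x).
  have := metric_triangle (f j (c x)) (f i (c x)) (f i x).
  rewrite (metric_sym (f j (c x)) (f i (c x))) (metric_sym (f i (c x)) (f i x)).
  move: cij fi fj; rewrite /phi; lra.
have mCE : measurable (~` E M) by exact: measurableC.
apply: le_trans (measureU2 _ _ _) _ => //; first exact: measurableU.
rewrite epsE EFinD; apply: leeD => //.
apply: le_trans (measureU2 _ _ _) _ => //.
rewrite EFinD; apply: leeD => //.
apply: (@le_trans _ _ (1 - mu (E M))%E).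
  by rewrite -(probability_setC mu (mE M)); exact: lexx.
move: muE; case: (mu (E M)) (probability_le1 mu (mE M)) => [r| |] //=.
rewrite !lee_fin !lte_fin => *; lra.
Qed.

(** * From convergence in measure of the maps to convergence in mean square *)

(** Near a point x of K half the radius of a ball around x inside U is a valid
    margin; the near-covering form of compactness makes the margin uniform. *)
Lemma compact_open_margin (R : realType) (X : pmetricType R) (K U : set X) :
  compact K -> open U -> K `<=` U -> exists2 delta : R, 0 < delta &
    forall x y, K x -> mdist x y < delta -> U y.
Proof.
move=> /compact_near_coveringP cK oU KU.
have : \forall d \near (0 : R)^'+,
    K `<=` [set x | forall y, mdist x y < d -> U y].
  apply: cK => x Kx.
  have /nbhs_ballP[r /= r0 rU] : nbhs x U.
    by apply: open_nbhs_nbhs; split => //; exact: KU.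
  have r20 : 0 < r / 2 by rewrite divr_gt0.
  exists (ball x (r / 2), [set d | d < r / 2]).
    by split => /=; [exact: nbhsx_ballx|exact: nbhs_right_lt].
  move=> [x' d] /= [xx' dr] y x'y; apply: rU; rewrite ballEmdist/=.
  rewrite [r]splitr (le_lt_trans (metric_triangle _ x' _))//.
  rewrite ltrD//; last exact: lt_trans dr.
  by move: xx'; rewrite ballEmdist.
move=> cov; near (0 : R)^'+ => d; exists d => // x y Kx.
suff /(_ x Kx y) : K `<=` [set x | forall y, mdist x y < d -> U y] by [].
by near: d.
Unshelve. all: by end_near. Qed.

(** By regularity B lies between a compact K and an open U of nearly the same
    measure; maps that move most points by less than the distance from K to the
    complement of U send most of K into U, and mostly into B by invariance. *)
Lemma set_recurrence (R : realType) (X : pmetricType R)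
    (mu : probability (borel X) R) (S : nat -> X -> X) :
  regular mu -> (forall k, continuous (S k)) ->
  (forall k, invariant_measure mu (S k)) ->
  (forall e : R, 0 < e ->
    \forall k \near \oo, (mu [set x | (e <= mdist (S k x) x)%R] <= e%:E)%E) ->
  forall B : set (borel X), measurable B -> forall e : R, 0 < e ->
    \forall k \near \oo, (mu (B `\` S k @^-1` B) <= e%:E)%E.
Proof.
move=> reg cS invS cvS B mB e e0.
pose r := e / 3; have r0 : 0 < r by rewrite divr_gt0.
have finB : mu B \is a fin_num by exact: fin_num_measure.
have [infB supB] := reg B mB.
have [U [oU BU] muU] : exists2 U : set (borel X), open (U : set X) /\ B `<=` U &
    (mu (U `\` B) <= r%:E)%E.
  have [|_ [U [oU BU] <-]] := lb_ereal_inf_adherent r0 _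
      (S := [set mu U | U in [set U : set X | open U /\ B `<=` U]]).
    by rewrite -infB.
  rewrite -infB => muU; exists U => //.
  have mU : measurable (U : set (borel X)) by exact: open_borel.
  rewrite (@measureD _ _ _ mu)//; last by rewrite -ge0_fin_numE// fin_num_measure.
  by rewrite setIidr// leeBlDr// addeC ltW.
have [K [cK KB] muK] : exists2 K : set (borel X), compact (K : set X) /\ K `<=` B &
    (mu (B `\` K) <= r%:E)%E.
  have [|_ [K [cK KB] <-]] := ub_ereal_sup_adherent r0 _
      (S := [set mu K | K in [set K : set X | compact K /\ K `<=` B]]).
    by rewrite -supB.
  rewrite -supB => muK; exists K => //.
  have mK : measurable (K : set (borel X)) by exact: compact_borel.
  have finK : mu K \is a fin_num by exact: fin_num_measure.
  rewrite (@measureD _ _ _ mu)//; last by rewrite -ge0_fin_numE// fin_num_measure.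
  by rewrite setIidr// leeBlDr// addeC -leeBlDr// ltW.
have [d d0 dU] := compact_open_margin cK oU (subset_trans KB BU).
pose m := Num.min d r; have m0 : 0 < m by rewrite lt_min d0.
have mS k C : measurable (C : set (borel X)) ->
    measurable (S k @^-1` C : set (borel X)).
  by move=> mC; rewrite -[X in measurable X]setTI; exact: continuous_borel.
have mU : measurable (U : set (borel X)) by exact: open_borel.
have mK : measurable (K : set (borel X)) by exact: compact_borel.
apply: filterS (cvS m m0) => k muk.
pose D : set (borel X) := [set x | (m <= mdist (S k x) x)%R].
have mD : measurable D.
  exact: displacement_borel.
have mUB : measurable (U `\` B) by exact: measurableD.
have mBK : measurable (B `\` K) by exact: measurableD.
(* A point x of B leaving B under S k is either in B minus K, or moved by at
   least m, or lands in U but outside B. *)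
apply: (@le_trans _ _ (mu ((B `\` K) `|` D `|` S k @^-1` (U `\` B)))).
  rewrite le_measure ?inE//.
  - by apply: measurableD => //; exact: mS.
  - by apply: measurableU; [exact: measurableU|exact: mS].
  move=> x [Bx nBx]; have [Kx|nKx] := pselect (K x); last by left; left.
  have [mx|mx] := leP m (mdist (S k x) x); first by left; right.
  right; split => //; apply: (dU x) => //.
  by rewrite metric_sym (lt_le_trans mx)// ge_min lexx.
apply: le_trans (measureU2 _ _ _) _ => //.
- exact: measurableU.
- exact: mS.
have -> : e%:E = (r%:E + r%:E + r%:E)%E.
  by rewrite -!EFinD; congr EFin; rewrite /r; field.
apply: leeD; last by rewrite -(invS k _ mUB) in muU; exact: muU.
apply: le_trans (measureU2 _ _ _) _ => //; apply: leeD => //.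
by rewrite (le_trans muk)// lee_fin ge_min lexx orbT.
Qed.

(** A simple function changes along S k only at the points that leave one of its
    finitely many level sets. *)
Lemma sfun_recurrence d (Y : measurableType d) (R : realType)
    (mu : probability Y R) (S : nat -> Y -> Y) :
  (forall k, measurable_fun setT (S k)) ->
  (forall B : set Y, measurable B -> forall e : R, 0 < e ->
    \forall k \near \oo, (mu (B `\` S k @^-1` B) <= e%:E)%E) ->
  forall (g : {sfun Y >-> R}) (e : R), 0 < e ->
    \forall k \near \oo, (mu [set x | g (S k x) != g x] <= e%:E)%E.
Proof.
move=> mS recS g e e0.
have mg r : measurable (g @^-1` [set r]) by exact: measurable_sfunP.
have mSg k r : measurable (S k @^-1` (g @^-1` [set r])).
  by rewrite -[X in measurable X]setTI; exact: mS.
pose D k r := g @^-1` [set r] `\` S k @^-1` (g @^-1` [set r]).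
have mD k r : measurable (D k r) by exact: measurableD.
have [s sE] := (finite_seqP _).1 (fimfunP g).
have mU k (l : seq R) : measurable (\big[setU/set0]_(r <- l) D k r).
  exact: bigsetU_measurable.
have small (l : seq R) : forall e', 0 < e' ->
    \forall k \near \oo, (mu (\big[setU/set0]_(r <- l) D k r) <= e'%:E)%E.
  elim: l => [|r l ih] e' e'0.
    by apply: nearW => k; rewrite big_nil measure0 lee_fin ltW.
  have e'20 : 0 < e' / 2 by rewrite divr_gt0.
  apply: filterS2 (recS _ (mg r) _ e'20) (ih _ e'20) => k muD muU.
  rewrite big_cons; apply: le_trans (measureU2 _ _ _) _ => //.
  by rewrite [e' in leRHS]splitr EFinD leeD.
apply: filterS (small s e e0) => k; apply: le_trans.
have sub : [set x | g (S k x) != g x] `<=` \big[setU/set0]_(r <- s) D k r.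
  move=> x /= /eqP gx; rewrite -bigcup_seq; exists (g x) => //.
  by have : [set` s] (g x) by rewrite -sE; exists x.
rewrite le_measure ?inE//.
by apply: measurable_neq => //; exact: measurableT_comp.
Qed.

(** Simple functions are dense in L1 and composition with S k is an L1 isometry,
    so it suffices to treat a simple function g, which is bounded by some M and for
    which the integral is at most 2 M times the measure of the set where g moves. *)
Lemma L1_recurrence d (Y : measurableType d) (R : realType)
    (mu : probability Y R) (S : nat -> Y -> Y) :
  (forall k, measurable_fun setT (S k)) ->
  (forall k, invariant_measure mu (S k)) ->
  (forall B : set Y, measurable B -> forall e : R, 0 < e ->
    \forall k \near \oo, (mu (B `\` S k @^-1` B) <= e%:E)%E) ->
  forall h : Y -> R, mu.-integrable setT (EFin \o h) -> forall e : R, 0 < e ->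
    \forall k \near \oo, (\int[mu]_x `|h (S k x) - h x|%:E <= e%:E)%E.
Proof.
move=> mS invS recS h ih e e0.
have mh : measurable_fun setT h by apply/measurable_EFinP; case/integrableP: ih.
pose r := e / 3; have r0 : 0 < r by rewrite divr_gt0.
have [g hg] : exists g : {sfun Y >-> R}, (\int[mu]_x `|h x - g x|%:E <= r%:E)%E.
  have [g_ [_ _ /fine_cvgP[finI /cvgrPdist_le/(_ _ r0) Ir]]] :=
    approximation_sfun_integrable measurableT ih.
  have [n [fin near0]] := filter_ex (filterI finI Ir); exists (g_ n); move: near0.
  rewrite sub0r normrN ger0_norm; last by apply: fine_ge0; exact: integral_ge0.
  by rewrite -lee_fin fineK.
have mg : measurable_fun setT g by [].
have [s sE] := (finite_seqP _).1 (fimfunP g).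
pose M := \sum_(c <- s) `|c|.
have M0 : 0 <= M by apply: sumr_ge0.
have gM x : `|g x| <= M.
  have gs : g x \in s by have : [set` s] (g x) by rewrite -sE; exists x.
  by rewrite /M (big_rem (g x))//= lerDl sumr_ge0.
pose c := r / (2 * M + 1).
have c0 : 0 < c by rewrite divr_gt0// ltr_wpDl// mulr_ge0.
apply: filterS (sfun_recurrence mS recS g c0) => k muk.
have mhS : measurable_fun setT (h \o S k) by exact: measurableT_comp.
have mgS : measurable_fun setT (g \o S k) by exact: measurableT_comp.
have mE f : measurable_fun setT f ->
    measurable_fun setT (fun x : Y => `|f x : R|%:E).
  by move=> mf; apply/measurable_EFinP; exact: measurableT_comp.
pose u1 x := `|h (S k x) - g (S k x)|%:E; pose u2 x := `|g (S k x) - g x|%:E.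
pose u3 x := `|h x - g x|%:E.
have m1 : measurable_fun setT u1 by apply: mE; exact: measurable_funB.
have m2 : measurable_fun setT u2 by apply: mE; exact: measurable_funB.
have m3 : measurable_fun setT u3 by apply: mE; exact: measurable_funB.
have I1 : (\int[mu]_x u1 x = \int[mu]_x u3 x)%E.
  rewrite (integral_invariant_measure (mS k) (invS k) m3) => // x.
  by rewrite lee_fin.
have I2 : (\int[mu]_x u2 x <= r%:E)%E.
  pose N := [set x | g (S k x) != g x].
  have mN : measurable N by exact: measurable_neq.
  apply: (@le_trans _ _ (\int[mu]_x ((2 * M)%:E * (\1_N x)%:E))%E).
    apply: ge0_le_integral => //.
    - by move=> x _; rewrite lee_fin.
    - by apply: measurable_funeM; apply/measurable_EFinP; exact: measurable_indic.
    move=> x _; rewrite -EFinM lee_fin indicE.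
    have [_|] := boolP (x \in N).
      rewrite mulr1 (le_trans (ler_normB _ _))// mulrDl mul1r lerD//.
    rewrite notin_setE /N/= => /negP; rewrite negbK => /eqP ->.
    by rewrite subrr normr0 mulr0.
  rewrite ge0_integralZl_EFin//; last 2 first.
  - by apply/measurable_EFinP; exact: measurable_indic.
  - by rewrite mulr_ge0.
  rewrite integral_indic// setIT.
  apply: (@le_trans _ _ ((2 * M)%:E * c%:E)%E).
    by apply: lee_pmul => //; rewrite lee_fin mulr_ge0.
  rewrite -EFinM lee_fin /c mulrA ler_pdivrMr ?ltr_wpDl ?mulr_ge0//.
  by rewrite mulrC ler_wpM2l ?(ltW r0)// lerDl.
(* u1 and u3 measure the error of replacing h by g, after and before S k. *)
apply: (@le_trans _ _ (\int[mu]_x (u1 x + u2 x + u3 x))%E).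
  apply: ge0_le_integral => //.
  - by apply: mE; exact: measurable_funB.
  - by apply: emeasurable_funD => //; exact: emeasurable_funD.
  move=> x _; rewrite -!EFinD lee_fin.
  rewrite (_ : h (S k x) - h x =
    (h (S k x) - g (S k x)) + (g (S k x) - g x) - (h x - g x)); last ring.
  by rewrite (le_trans (ler_normB _ _))// lerD2r ler_normD.
rewrite ge0_integralD//; last 3 first.
- by move=> x _; rewrite /u1 /u2 -EFinD lee_fin addr_ge0.
- exact: emeasurable_funD.
- by move=> x _; rewrite lee_fin.
rewrite ge0_integralD//; last 2 first.
- by move=> x _; rewrite lee_fin.
- by move=> x _; rewrite lee_fin.
have -> : e%:E = (r%:E + r%:E + r%:E)%E.
  by rewrite -!EFinD; congr EFin; rewrite /r; field.
by apply: leeD => //; apply: leeD => //; rewrite I1.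
Qed.

(** This inequality bounds an L2 distance of f and g by the L1 distance of
    their signed squares f |f| and g |g|; composition with a map commutes with
    taking signed squares. *)
Lemma sqr_dist_le_signed_sqr (R : realDomainType) (a b : R) :
  `|a - b| ^+ 2 <= 2 * `|a * `|a| - b * `|b| |.
Proof.
rewrite real_normK ?num_real//.
have := ler_norm (a * `|a| - b * `|b|); have := ler_norm (b * `|b| - a * `|a|).
rewrite [X in _ <= X -> _]distrC; have := sqr_ge0 (a + b).
by have [a0|a0] := ger0P a; have [b0|b0] := ger0P b; have [ab|ab] := leP a b; nra.
Qed.

Lemma L2_recurrence d (Y : measurableType d) (R : realType)
    (mu : probability Y R) (S : nat -> Y -> Y) (f : Y -> R) :
  (forall k, measurable_fun setT (S k)) ->
  (forall h : Y -> R, mu.-integrable setT (EFin \o h) -> forall e : R, 0 < e ->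
    \forall k \near \oo, (\int[mu]_x `|h (S k x) - h x|%:E <= e%:E)%E) ->
  f \in Lfun mu 2%:E ->
  ('N[mu]_2%:E[(fun x => (f (S k x) - f x)%:E)] @[k --> \oo] --> 0)%E.
Proof.
move=> mS rec1 fL2.
have mf : measurable_fun setT f by move: fL2; rewrite inE => /andP[]; rewrite inE.
pose h x := f x * `|f x|.
have mh : measurable_fun setT h.
  by apply: measurable_funM => //; exact: measurableT_comp.
have ih : mu.-integrable setT (EFin \o h).
  apply: le_integrable (Lfun2_integrable_sqr fL2) => //.
    exact/measurable_EFinP.
  by move=> x _ /=; rewrite lee_fin /h normrM normr_id normrX expr2.
have small e : 0 < e -> \forall k \near \oo,
    ('N[mu]_2%:E[(fun x => (f (S k x) - f x)%:E)] <= e%:E)%E.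
  move=> e0; have e20 : 0 < e ^+ 2 / 2 by rewrite divr_gt0// exprn_gt0.
  apply: filterS (rec1 h ih _ e20) => k muk; rewrite unlock.
  have I : (\int[mu]_x (`|(f (S k x) - f x)%:E| `^ 2) <= (e ^+ 2)%:E)%E.
    have -> : ((e ^+ 2)%:E = 2%:E * (e ^+ 2 / 2)%:E)%E.
      by rewrite -EFinM; congr EFin; field.
    apply: (@le_trans _ _ (2%:E * \int[mu]_x `|h (S k x) - h x|%:E)%E);
      last by rewrite lee_pmul2l.
    have mhS : measurable_fun setT (fun x => `|h (S k x) - h x|).
      apply: measurableT_comp => //; apply: measurable_funB => //.
      exact: measurableT_comp.
    rewrite -ge0_integralZl_EFin//; last exact/measurable_EFinP.
    under [leLHS]eq_integral do rewrite abse_EFin poweR_EFin powR_mulrn//.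
    apply: ge0_le_integral => //.
    - apply/measurable_EFinP; apply: measurable_funX; apply: measurableT_comp => //.
      by apply: measurable_funB => //; exact: measurableT_comp.
    - by apply: measurable_funeM; exact/measurable_EFinP.
    - by move=> x _; rewrite -EFinM lee_fin; exact: sqr_dist_le_signed_sqr.
  have -> : e%:E = ((e ^+ 2)%:E `^ 2^-1)%E.
    by rewrite poweR_EFin powR12_sqrt ?sqr_ge0// sqrtr_sqr gtr0_norm.
  apply: gt0_ler_poweR => //; rewrite in_itv/= leey andbT.
  - by apply: integral_ge0 => x _; rewrite lee_fin powR_ge0.
  - by rewrite lee_fin exprn_ge0// ltW.
apply/fine_cvgP; split.
  apply: filterS (small 1 ltr01) => k Nk.
  by rewrite ge0_fin_numE ?Lnorm_ge0// (le_lt_trans Nk) ?ltry.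
apply/cvgrPdist_le => e e0; apply: filterS (small e e0) => k Nk.
rewrite sub0r normrN ger0_norm ?fine_ge0 ?Lnorm_ge0//.
rewrite -lee_fin fineK// ge0_fin_numE ?Lnorm_ge0// (le_lt_trans Nk) ?ltry//.
Qed.

(** * Rigidity *)

Theorem theorem1p4 (R : realType) (X : pmetricType R) (T : X -> X)
    (mu : probability (borel X) R) :
  compact [set: X] -> homeomorphism T ->
  regular mu -> invariant_measure mu T ->
  (exists a : nat -> nat,
     [/\ increasing_seq a, (0 < upper_density R (range a))%E &
         measure_mean_equicontinuous mu T a]) ->
  rigid mu T.
Proof.
move=> cX [_ [_ _ cT _]] reg inv [a [inca _ meq]].
have rec k N : exists n, (N <= n)%N /\
    (mu [set x | (k.+1%:R^-1 <= mdist (iter n T x) x)%R] <= (k.+1%:R^-1)%:E)%E.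
  have k0 : 0 < k.+1%:R^-1 :> R by rewrite invr_gt0.
  by have [n] := recurrence_in_measure cX cT inv inca meq N k0; exists n.
have [F FP] := choice (fun kN => rec kN.1 kN.2).
(* Asking at stage k.+1 for a return time above the previous one makes the
   sequence increasing. *)
pose t := fix t k := if k is k'.+1 then F (k, (t k').+1) else F (0%N, 0%N).
exists t; split.
  by apply/increasing_seqP => k; exact: (FP (k.+1, (t k).+1)).1.
have tP k : (mu [set x | (k.+1%:R^-1 <= mdist (iter (t k) T x) x)%R] <=
    (k.+1%:R^-1)%:E)%E.
  by case: k => [|k]; exact: (FP (_, _)).2.
have cit k : continuous (iter (t k) T) by exact: continuous_iter.
have mit k : measurable_fun setT (iter (t k) T : borel X -> borel X).
  exact: continuous_borel.
have invt k : invariant_measure mu (iter (t k) T).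
  by apply: invariant_measure_iter => //; exact: continuous_borel.
move=> f fL2; apply: L2_recurrence => //.
apply: L1_recurrence => //; apply: set_recurrence => // e e0.
have [N _ Ne] := near_infty_natSinv_lt (PosNum e0).
exists N => // k /Ne /= ke.
apply: (@le_trans _ _ (k.+1%:R^-1)%:E); last by rewrite lee_fin ltW.
apply: le_trans (tP k); rewrite le_measure ?inE//; try exact: displacement_borel.
by move=> x /=; apply: le_trans; exact: ltW.
Qed.
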